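(* Let $G$ be a ring graph (cycle) with an odd number $n\ge 5$ of vertices. Then $$\tilde{\chi}(G)=\tilde{\chi}_2(G)=\tilde{\chi}_{XZ}(G)=\chi_{\mathrm{LC}}(G)=\chi(G)=3 .$$
   Context: Graphs are finite and simple, with vertex set $V=\{1,\dots,n\}$. The graph state $|G\rangle\in(\mathbb{C}^2)^{\otimes n}$ is the unique (up to phase) unit vector that is a common $+1$ eigenvector of $S_j=X_j\prod_{k:\{j,k\}\in E}Z_k$, $j=1,\dots,n$, with $X_j,Y_j,Z_j$ the Pauli matrices on qubit $j$. A complete Pauli measurement (setting) $\mu$ measures exactly one of $X,Y,Z$ on each qubit; its outcome projectors $\Pi_{\mu,\mathbf v}$, $\mathbf v\in\{0,1\}^n$, are tensor products of the projectors onto the eigenvectors with eigenvalue $(-1)^{v_j}$ of the Pauli operators measured on qubits $j=1,\dots,n$. A test operator based on $\mu$ is an operator $0\le E\le\mathbb{1}$ with $E|G\rangle=|G\rangle$ that is a linear combination of the $\Pi_{\mu,\mathbf v}$. The state $|G\rangle$ can be verified by a set of settings $\mathscr M$ if there is a convex combination $\Omega=\sum_{\mu\in\mathscr M}p_\mu E_\mu$ of test operators $E_\mu$ based on $\mu\in\mathscr M$ whose second largest eigenvalue (counted with multiplicity) is strictly less than $1$. $\tilde\chi(G)$ is the minimum number of settings in a set $\mathscr M$ that can verify $|G\rangle$. $\tilde\chi_2(G)$ is the minimum number under the restriction that on each qubit at most two of the three Pauli operators $X,Y,Z$ occur among the settings in $\mathscr M$ (the pair may depend on the qubit). $\tilde\chi_{XZ}(G)$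 is the minimum number under the restriction that every setting measures only $X$ or $Z$ on each qubit. $\chi(G)$ is the chromatic number. Local complementation at a vertex $j$ replaces the subgraph induced on the neighborhood of $j$ by its complement; $\chi_{\mathrm{LC}}(G)$ is the minimum of $\chi(G')$ over all graphs $G'$ obtained from $G$ by finite sequences of local complementations. *)

(* Defs.v *)
From HB Require Import structures.
From mathcomp Require Import all_boot all_order all_fingroup all_algebra.
From mathcomp Require Import complex.
From mathcomp Require Import all_classical all_reals.

Set Implicit Arguments.
Unset Strict Implicit.
Unset Printing Implicit Defensive.

Import Order.TTheory GRing.Theory Num.Theory.

Local Open Scope ring_scope.
Local Open Scope sesquilinear_scope.

(* 0 when P is empty; 0 is never the size of a verifying set of settings, since
   the empty set admits no convex combination. *)
Definition minimum (P : nat -> Prop) : nat :=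
  xget 0%N [set k | P k /\ forall m, P m -> (k <= m)%N]%classic.

Section Graphs.
Variable n : nat.

Record sgraph := SGraph {
  adj :> rel 'I_n;
  adj_sym : symmetric adj;
  adj_irr : irreflexive adj }.

Definition colorable (G : sgraph) (k : nat) : Prop :=
  exists c : 'I_n -> 'I_k, forall i j, G i j -> c i != c j.

Definition chromatic_number (G : sgraph) : nat := minimum (colorable G).

Definition lc_adj (G : sgraph) (j : 'I_n) : rel 'I_n :=
  fun a b => G a b (+) [&& a != b, G j a & G j b].

Lemma lc_adj_sym G j : symmetric (lc_adj G j).
Proof. by move=> a b; rewrite /lc_adj adj_sym eq_sym (andbC (G j a)). Qed.

Lemma lc_adj_irr G j : irreflexive (lc_adj G j).
Proof. by move=> a; rewrite /lc_adj adj_irr eqxx. Qed.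

Definition local_complement (G : sgraph) (j : 'I_n) : sgraph :=
  SGraph (lc_adj_sym G j) (lc_adj_irr G j).

Definition LC_chromatic_number (G : sgraph) : nat :=
  minimum (fun k => exists js : seq 'I_n,
    chromatic_number (foldl local_complement G js) = k).

(* ordS is the cyclic successor i |-> i + 1 mod n on 'I_n. *)
Definition is_ring_graph (G : sgraph) : Prop :=
  exists s : {perm 'I_n},
    forall i j, G (s i) (s j) = (j == ordS i) || (i == ordS j).

End Graphs.

Variant pauli := PauliX | PauliY | PauliZ.

Definition nat_of_pauli (p : pauli) : nat :=
  match p with PauliX => 0 | PauliY => 1 | PauliZ => 2 end.
Definition ord_of_pauli (p : pauli) : 'I_3 := inord (nat_of_pauli p).
Definition pauli_of_ord (i : 'I_3) : pauli :=
  match val i with 0%N => PauliX | 1%N => PauliY | _ => PauliZ end.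

Lemma ord_of_pauliK : cancel ord_of_pauli pauli_of_ord.
Proof. by case; rewrite /pauli_of_ord /ord_of_pauli /= inordK. Qed.

HB.instance Definition _ := Finite.copy pauli (can_type ord_of_pauliK).

Notation setting n := {ffun 'I_n -> pauli}.
Notation bits n := {ffun 'I_n -> 'I_2}.

Section QuantumStates.
Variables (C : numClosedFieldType) (n : nat).

(* The computational basis of the n-qubit space is indexed by bit strings;
   enum_val turns a matrix index into the bit string that it stands for. *)
Definition operator : Type := 'M[C]_#|{: bits n}|.
Definition ket : Type := 'cV[C]_#|{: bits n}|.

Definition tensor (A : 'I_n -> 'M[C]_2) : operator :=
  \matrix_(a, b) \prod_(j < n)
    A j ((enum_val a : bits n) j) ((enum_val b : bits n) j).

Definition pauli_mx (p : pauli) : 'M[C]_2 :=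
  match p with
  | PauliX => delta_mx 0 1 + delta_mx 1 0
  | PauliY => 'i *: (delta_mx 1 0 - delta_mx 0 1)
  | PauliZ => delta_mx 0 0 - delta_mx 1 1
  end.

Definition pauli_at (p : pauli) (j : 'I_n) : operator :=
  tensor (fun k => if k == j then pauli_mx p else 1%:M).

Definition stabilizer (G : sgraph n) (j : 'I_n) : operator :=
  pauli_at PauliX j * \prod_(k | G j k) pauli_at PauliZ k.

Definition is_graph_state (G : sgraph n) (psi : ket) : Prop :=
  psi^t* *m psi = 1%:M /\ forall j, stabilizer G j *m psi = psi.

(* eigenspace and proj_ortho act on row vectors; as pauli_mx is Hermitian, the
   resulting matrix is also the orthogonal projector, acting on column vectors,
   onto the usual eigenspace (see pauli_projE). *)
Definition pauli_proj (p : pauli) (v : 'I_2) : 'M[C]_2 :=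
  proj_ortho (eigenspace (pauli_mx p) ((-1) ^+ v)).

Definition outcome_proj (mu : setting n) (v : bits n) : operator :=
  tensor (fun j => pauli_proj (mu j) (v j)).

Definition psd (A : operator) : Prop :=
  A \is hermsymmx /\ forall x : ket, 0 <= (x^t* *m A *m x) 0 0.

Definition test_operator (psi : ket) (mu : setting n) (E : operator) : Prop :=
  [/\ psd E, psd (1%:M - E), E *m psi = psi &
      exists c : bits n -> C, E = \sum_v c v *: outcome_proj mu v].

(* The ordering of C only compares numbers that differ by a real one, so
   sortedness forces the eigenvalues of A to be comparable, as they are for the
   Hermitian operators considered here. *)
Definition sorted_spectrum (A : operator) (s : seq C) : Prop :=
  char_poly A = \prod_(a <- s) ('X - a%:P) /\ sorted >=%R s.

Definition second_eigenvalue_lt1 (A : operator) : Prop :=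
  exists2 s, sorted_spectrum A s & s`_1 < 1.

(* The graph state being unique up to phase, and test operators and spectra
   being insensitive to the phase, the choice of psi is immaterial. *)
Definition can_verify (G : sgraph n) (M : {set setting n}) : Prop :=
  exists psi : ket, is_graph_state G psi /\
  exists (p : setting n -> C) (E : setting n -> operator),
    [/\ forall mu, mu \in M -> 0 <= p mu,
        \sum_(mu in M) p mu = 1,
        forall mu, mu \in M -> test_operator psi mu (E mu) &
        second_eigenvalue_lt1 (\sum_(mu in M) p mu *: E mu)].

Definition two_paulis_per_qubit (M : {set setting n}) : Prop :=
  forall j, (#|[set (mu : setting n) j | mu in M]| <= 2)%N.

Definition XZ_settings (M : {set setting n}) : Prop :=
  forall mu : setting n, mu \in M -> forall j, mu j != PauliY.

Definition min_settings (restr : {set setting n} -> Prop) (G : sgraph n) : nat :=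
  minimum (fun k => exists M : {set setting n},
    [/\ restr M, can_verify G M & #|M| = k]).

Definition chi_tilde : sgraph n -> nat := min_settings (fun=> True).
Definition chi_tilde2 : sgraph n -> nat := min_settings two_paulis_per_qubit.
Definition chi_tildeXZ : sgraph n -> nat := min_settings XZ_settings.

End QuantumStates.

Lemma pauli_mxK (C : numClosedFieldType) (p : pauli) :
  pauli_mx C p *m pauli_mx C p = 1%:M.
Proof.
apply/matrixP=> -[[|[|//]] ?] [[|[|//]] ?];
rewrite !mxE big_ord_recr /= big_ord1; case: p; rewrite !mxE /=.
all: rewrite ?(mulr0, mul0r, mulr1, mul1r, addr0, add0r, sub0r, subr0).
all: rewrite ?(mulrN1, mulNr, mulrN, mulr1, mulCii, opprK, oppr0).
all: by rewrite ?(mulr0, mul0r, addr0, add0r, subr0, oppr0).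
Qed.

Lemma pauli_mx_hermitian (C : numClosedFieldType) (p : pauli) :
  (pauli_mx C p)^t* = pauli_mx C p.
Proof.
apply/matrixP=> -[[|[|//]] ?] [[|[|//]] ?]; case: p; rewrite !mxE /=.
all: rewrite ?(mulr0, mulr1, addr0, add0r, sub0r, subr0, oppr0).
all: rewrite ?(rmorphM, rmorphN1, conjC0, conjC1) //= ?conjCi.
all: by rewrite ?mulNr ?mulrN ?mulr1 ?opprK.
Qed.

Lemma pauli_projE (C : numClosedFieldType) (p : pauli) (v : 'I_2) :
  pauli_proj C p v = 2^-1 *: (1%:M + (-1) ^+ v *: pauli_mx C p).
Proof.
rewrite /pauli_proj; set A := pauli_mx C p; set l : C := (-1) ^+ v.
set U := eigenspace A l; set P := 2^-1 *: _.
have AA : A *m A = 1%:M := pauli_mxK C p.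
have Ah : A^t* = A := pauli_mx_hermitian C p.
have ll : l * l = 1 by rewrite -expr2 sqrr_sign.
have lc : l^* = l by rewrite rmorph_sign.
have PU : (P <= U)%MS.
  apply/eigenspaceP; rewrite -scalemxAl mulmxDl mul1mx -scalemxAl AA.
  rewrite [RHS]scalerA [l * _]mulrC -[RHS]scalerA [in RHS]scalerDr.
  by rewrite [in RHS]scalerA ll scale1r addrC.
have UA : U *m A = l *: U by apply/eigenspaceP.
rewrite -[LHS]mul1mx -[1%:M](subrK P) mulmxDl (proj_ortho_id PU) proj_ortho_0.
  by rewrite add0r.
rewrite orthomx_sym; apply/orthomx1P.
have -> : (1%:M - P)^t* = 1%:M - P.
  apply/matrixP=> i j; have Aij : (A j i)^* = A i j by rewrite -[in RHS]Ah !mxE.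
  move: Aij lc; rewrite !mxE; move: (A i j) (A j i) => a b <- lc.
  rewrite rmorphB rmorphM rmorphD rmorphM /= lc fmorphV !rmorph_nat.
  by rewrite (eq_sym j i).
rewrite mulmxBr mulmx1 -scalemxAr mulmxDr mulmx1 -scalemxAr UA scalerA ll.
by rewrite scale1r -mulr2n -scaler_nat scalerA mulVf ?pnatr_eq0 // scale1r subrr.
Qed.

(* Main.v *)
(* A set of Pauli strings is handled through the binary symplectic form: P
   commutes with every stabilizer generator of G iff it is in the stabilizer
   group up to sign.  Two settings verify G only if the stabilizer elements that
   they measure generate the whole group (splits): otherwise some Pauli operator
   Q commutes with all of these elements but not with the group, every test
   operator fixes Q psi as well as psi, and Q psi is orthogonal to psi.
   On a ring with at least five vertices, a splitting by two settings differing
   on every qubit projects each generator S_j to a stabilizer element supported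
   on j - 1, j, j + 1, that is, to 1 or S_j; so each S_j is measured by one of the
   two settings, which yields a proper 2-coloring.  Splitting is invariant under
   local complementation and holds for bipartite graphs, so no graph in the orbit
   of an odd ring is bipartite.  Conversely, a k-coloring yields k settings
   (X on one color class, Z elsewhere), whose test operators are simultaneously
   diagonal in the graph basis Z^w psi. *)

Require Import Defs.
From mathcomp Require Import all_boot all_order all_fingroup all_algebra.
From mathcomp Require Import complex.
From mathcomp Require Import all_classical all_reals.

Set Implicit Arguments.
Unset Strict Implicit.
Unset Printing Implicit Defensive.

Import Order.TTheory GRing.Theory Num.Theory.

(** * The symplectic formalism and local complementation *)

Lemma minimumP (P : nat -> Prop) k :
  P k -> (forall m, P m -> (k <= m)%N) -> minimum P = k.
Proof.
move=> Pk kmin; rewrite /minimum; apply: xget_unique; first by split.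
by move=> y [Py ymin]; apply/eqP; rewrite eqn_leq ymin //= kmin.
Qed.

Lemma minimum_spec (P : nat -> Prop) m :
  P m -> P (minimum P) /\ (forall m', P m' -> (minimum P <= m')%N).
Proof.
move=> Pm; have [k Pk kmin] := (@ex_minnP (fun k => `[< P k >])
  (ex_intro _ m (introT (asboolP _) Pm))).
rewrite (@minimumP P k); first by split=> [|m' Pm']; [exact/asboolP|exact/kmin/asboolP].
  exact/asboolP.
by move=> m' Pm'; apply/kmin/asboolP.
Qed.

Lemma minimum_le (P : nat -> Prop) m : P m -> (minimum P <= m)%N.
Proof. by move=> Pm; have [_] := minimum_spec Pm; apply. Qed.

Section Symplectic.
Variable n : nat.
Implicit Types (G : sgraph n) (P Q : 'I_n -> bool * bool) (mu : setting n).

(* The Pauli operator X^x Z^z is encoded, up to phase, by the pair (x, z). *)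
Definition pauli_vec (p : pauli) : bool * bool :=
  match p with
  | PauliX => (true, false) | PauliY => (true, true) | PauliZ => (false, true)
  end.

Definition vec_pauli (p : bool * bool) : pauli :=
  match p with
  | (true, false) => PauliX | (true, true) => PauliY | _ => PauliZ
  end.

(** True exactly when the two one-qubit Paulis anticommute; [omega] adds these bits up to the
    commutation sign of two strings. *)
Definition sympl (p q : bool * bool) : bool := p.1 && q.2 (+) p.2 && q.1.

Definition omega P Q : bool := \big[addb/false]_(j < n) sympl (P j) (Q j).

Definition gen G (j : 'I_n) : 'I_n -> bool * bool := fun k => (k == j, G j k).

(** Qubitwise commutation: each factor of [P] is the identity or the Pauli that [mu] measures there,
    so the outcomes determine the value of [P]. *)
Definition measured mu P : Prop :=
  forall j, sympl (P j) (pauli_vec (mu j)) = false.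

(* Equivalently, P is up to sign an element of the stabilizer group. *)
Definition centralizes G P : Prop := forall k, omega P (gen G k) = false.

(** Generation of the stabilizer group in dual form: the group is its own symplectic complement, so
    the measured elements generate it iff nothing outside it commutes with all of them. This avoids
    spans and ranks. *)
Definition splits G (mu1 mu2 : setting n) : Prop :=
  forall Q,
    (forall P, centralizes G P -> measured mu1 P \/ measured mu2 P ->
       omega P Q = false) ->
    centralizes G Q.

Lemma omegaC P Q : omega P Q = omega Q P.
Proof.
by apply: eq_bigr => j _; rewrite /sympl addbC andbC [_ && (Q j).2]andbC.
Qed.

Lemma measured_omega mu P Q : measured mu P -> measured mu Q -> omega P Q = false.
Proof.
move=> mP mQ; apply: big1 => j _; move: (mP j) (mQ j).
by case: (mu j); case: (P j) => [[] []]; case: (Q j) => [[] []].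
Qed.

Lemma gen_centralizes G j : centralizes G (gen G j).
Proof.
move=> k; rewrite /omega /sympl /gen /= big_split /=.
rewrite [X in X (+) _](bigD1 j) //= eqxx big1 /= => [|i /negPf->//].
rewrite [X in _ (+) X](bigD1 k) //= eqxx andbT big1 /= => [|i /negPf->]; last first.
  by rewrite andbF.
by rewrite !addbF adj_sym addbb.
Qed.

Lemma colorable2_splits G (c : 'I_n -> 'I_2) :
  (forall i j, G i j -> c i != c j) -> exists mu1 mu2, splits G mu1 mu2.
Proof.
move=> cP; pose mu t : setting n := [ffun j => if c j == t then PauliX else PauliZ].
exists (mu 0%R), (mu 1%R) => Q QP k; rewrite omegaC; apply: QP.
  exact: gen_centralizes.
have mk : measured (mu (c k)) (gen G k).
  move=> j; rewrite ffunE /gen /sympl; case: (c j =P c k) => cjk /=.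
    by rewrite andbF andbT /=; apply/negP => /cP; rewrite cjk eqxx.
  by rewrite andbF addbF andbT; apply/eqP => jk; rewrite jk in cjk.
have [e|e] : c k = 0%R \/ c k = 1%R.
- by case: (c k) => -[|[|//]] lt; [left|right]; exact: val_inj.
- by left; rewrite -e.
- by right; rewrite -e.
Qed.

Definition lc_map G (j : 'I_n) P : 'I_n -> bool * bool := fun k =>
  if k == j then ((P k).1 (+) (P k).2, (P k).2)
  else if G j k then ((P k).1, (P k).2 (+) (P k).1) else P k.

Lemma lc_mapK G j : involutive (lc_map G j).
Proof.
move=> P; apply/funext => k; rewrite /lc_map.
by case: (k == j); case: (G j k); case: (P k) => [[] []].
Qed.

Lemma lc_map_omega G j P Q : omega (lc_map G j P) (lc_map G j Q) = omega P Q.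
Proof.
apply: eq_bigr => k _; rewrite /lc_map.
by case: (k == j); case: (G j k); case: (P k) (Q k) => [[] []] [[] []].
Qed.

(** Componentwise xor is multiplication of Pauli strings: the images are S_k, or S_k S_j when k is a
    neighbor of j, and these generate the same group as the S_k. *)
Lemma lc_map_gen G j k i :
  lc_map G j (gen (local_complement G j) k) i =
  if G j k then ((gen G k i).1 (+) (gen G j i).1, (gen G k i).2 (+) (gen G j i).2)
  else gen G k i.
Proof.
rewrite /lc_map /gen /= /lc_adj.
have [->|nij] := eqVneq i j.
  rewrite !adj_irr (adj_sym G k j) !andbF addbF.
  have [<-|njk] := eqVneq j k; first by rewrite adj_irr.
  by case: (G j k).
have [->|nik] := eqVneq i k.
  by rewrite !adj_irr; case: (G j k).
  by rewrite ?andTb; case: (G j k) (G j i) => [] []; rewrite /= ?addbF ?addbT.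
Qed.

Lemma omega_lc_gen G j k P :
  omega P (gen (local_complement G j) k) =
  omega (lc_map G j P) (gen G k) (+)
    (G j k && omega (lc_map G j P) (gen G j)).
Proof.
rewrite -(lc_map_omega G j); case Gjk: (G j k) => /=; last first.
  by rewrite addbF; apply: eq_bigr => i _; rewrite lc_map_gen Gjk.
rewrite /omega -big_split; apply: eq_bigr => i _; rewrite lc_map_gen Gjk.
by case: (lc_map G j P i) (gen G k i) (gen G j i) => [[] []] [[] []] [[] []].
Qed.

Lemma lc_centralizes G j P :
  centralizes (local_complement G j) P <-> centralizes G (lc_map G j P).
Proof.
split=> cP k; last by rewrite omega_lc_gen !cP andbF.
(* The generator at [j] is carried to S_j itself, so commutation with it removes the correction term
   for every other [k]. *)
have cj := cP j; rewrite omega_lc_gen adj_irr addbF in cj.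
by have := cP k; rewrite omega_lc_gen cj andbF addbF.
Qed.

Lemma lc_splits G j :
  (exists mu1 mu2, splits (local_complement G j) mu1 mu2) ->
  exists mu1 mu2, splits G mu1 mu2.
Proof.
(* [lc_map] permutes the three Paulis on each qubit, hence carries settings to settings. *)
pose f mu : setting n :=
  [ffun k => vec_pauli (lc_map G j (fun i => pauli_vec (mu i)) k)].
have fP mu P : measured mu P -> measured (f mu) (lc_map G j P).
  move=> mP k; move: (mP k); rewrite ffunE /lc_map.
  by case: (k == j); case: (G j k); case: (mu k) (P k) => [] [[] []].
move=> [mu1 [mu2 sp]]; exists (f mu1), (f mu2) => Q QP.
rewrite -(lc_mapK G j Q) -lc_centralizes; apply: sp => P /lc_centralizes cP mP.
rewrite -(lc_map_omega G j) lc_mapK; apply: QP => //.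
by case: mP => mP; [left|right]; exact: fP.
Qed.

Lemma LC_orbit_splits G js :
  (exists mu1 mu2, splits (foldl (@local_complement n) G js) mu1 mu2) ->
  exists mu1 mu2, splits G mu1 mu2.
Proof. by elim: js G => //= j js IH G /IH/lc_splits. Qed.

End Symplectic.

(** * Odd rings *)

Section Ring.
Variables (n : nat) (G : sgraph n).
Implicit Types (P Q : 'I_n -> bool * bool) (mu : setting n).

(* When m1 and m2 differ they form a basis of the Paulis on one qubit; this is
   the component of p along m1. *)
Definition component (m1 m2 : pauli) (p : bool * bool) : bool * bool :=
  if sympl p (pauli_vec m2) then pauli_vec m1 else (false, false).

(** A [p] commuting with [m2] is 1 or [m2], so it does not see the part of [q] along [m2]. *)
Lemma sympl_component m1 m2 p q : m1 != m2 -> sympl p (pauli_vec m2) = false ->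
  sympl p (component m1 m2 q) = sympl p q.
Proof.
by move/eqP; case: p q m1 m2 => [[] []] [[] []] [] [] // ne; case: ne.
Qed.

Lemma component_measured m1 m2 q : sympl (component m1 m2 q) (pauli_vec m1) = false.
Proof. by rewrite /component; case: ifP; case: m1. Qed.

(** An element measured by [mu1] commutes with the projection because both are measured by [mu1];
    one measured by [mu2] pairs with the projection as it does with S_j. *)
Lemma splits_component mu1 mu2 j : (forall k, mu1 k != mu2 k) ->
  splits G mu1 mu2 ->
  centralizes G (fun k => component (mu1 k) (mu2 k) (gen G j k)).
Proof.
move=> neq sp; apply: sp => P cP [] mP.
  by apply: (measured_omega mP) => k; apply: component_measured.
rewrite -[RHS](cP j); apply: eq_bigr => k _; exact: sympl_component.
Qed.

(** If both settings measure the same Pauli at [j], that one-qubit Pauli commutes with every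
    measured element; yet it anticommutes with S_j or with S_k for a neighbor [k], which act at [j]
    as X and Z. *)
Lemma splits_neq mu1 mu2 : (forall j, exists k, G j k) ->
  splits G mu1 mu2 -> forall j, mu1 j != mu2 j.
Proof.
move=> noiso sp j; apply/eqP => eq12.
pose Q := fun k => if k == j then pauli_vec (mu1 j) else (false, false).
have oQ P : omega P Q = sympl (P j) (pauli_vec (mu1 j)).
  rewrite /omega (bigD1 j) //= big1 /Q ?eqxx ?addbF // => i /negPf->.
  by rewrite /sympl !andbF.
have cQ : centralizes G Q.
  by apply: sp => P _ [] mP; rewrite oQ; [|rewrite eq12]; apply: mP.
have [k Gjk] := noiso j; have := cQ j; have := cQ k.
rewrite !(omegaC Q) !oQ /gen eqxx adj_irr adj_sym Gjk.
have -> : (j == k) = false by apply/eqP => e; rewrite e adj_irr in Gjk.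
by case: (mu1 j).
Qed.

Variables nxt prv : 'I_n -> 'I_n.
Hypotheses (nxtK : cancel nxt prv) (prvK : cancel prv nxt).
Hypothesis G_ring : forall u v, G u v = (v == nxt u) || (v == prv u).
Hypothesis nxt_acyclic : forall m v, (0 < m < 5)%N -> iter m nxt v != v.

Lemma ring_omega Q k :
  omega Q (gen G k) = (Q k).2 (+) ((Q (nxt k)).1 (+) (Q (prv k)).1).
Proof.
rewrite /omega /sympl /gen /= big_split /= addbC.
(* The two neighbors must be distinct to contribute separately. *)
have nP : prv k != nxt k.
  apply/eqP => e; have /eqP := nxt_acyclic (prv k) (isT : 0 < 2 < 5)%N.
  by apply; rewrite /= prvK.
congr (_ (+) _).
  rewrite (bigD1 k) //= eqxx big1 => [|i /negPf->]; last by rewrite andbF.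
  by rewrite andbT addbF.
rewrite (bigD1 (nxt k)) //= (bigD1 (prv k)) //= big1 => [|i /andP[ni pi]].
  by rewrite !G_ring !eqxx orbT !andbT addbF.
by rewrite G_ring (negPf ni) (negPf pi) andbF.
Qed.

(** Commutation with the generators at distance at most 2 from [j] forces the projection [Q] of S_j
    along [mu1] to be 1 or S_j. If it is S_j, then [mu1] measures S_j; if it is 1, S_j has only
    components along [mu2]. *)
Lemma ring_component mu1 mu2 j : (forall k, mu1 k != mu2 k) ->
  splits G mu1 mu2 -> measured mu1 (gen G j) \/ measured mu2 (gen G j).
Proof.
move=> neq /(splits_component j neq); set Q := (fun k => _) => cQ.
have Qout k : k != j -> k != nxt j -> k != prv j -> Q k = (false, false).
  rewrite /Q /gen G_ring => /negPf-> /negPf-> /negPf->.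
  by rewrite /component.
(* Seven consecutive vertices centered at [j = v 3]. They may wrap around when n is 5 or 6, but only
   vertices at most four steps apart are compared. *)
pose v m := iter m nxt (prv (prv (prv j))).
have v3 : v 3 = j by rewrite /v /= !prvK.
have nv m : nxt (v m) = v m.+1 by [].
have pv m : prv (v m.+1) = v m by rewrite /v iterS nxtK.
have ne i k : (i < k < i + 5)%N -> v i != v k.
  move=> /andP[ik ki]; rewrite eq_sym -(subnK (ltnW ik)) /v iterD.
  by apply: nxt_acyclic; rewrite subn_gt0 ik ltn_subLR // ltnW.
clearbody v; have Qout0 := Qout.
have {}Qout m : (m \in [:: 0; 1; 5; 6])%N -> Q (v m) = (false, false).
  rewrite !inE => m_in; apply: Qout; rewrite -v3 ?nv ?pv;
  by case/or4P: m_in => /eqP->; first [exact: ne | rewrite eq_sym; exact: ne].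
have eqn m : (Q (v m.+1)).2 (+) ((Q (v m.+2)).1 (+) (Q (v m)).1) = false.
  by have := cQ (v m.+1); rewrite ring_omega nv pv.
have QE k : Q k = if (Q j).1 then gen G j k else (false, false).
  have [n23 n34] := (ne 2 3 isT, ne 3 4 isT)%N.
  move: (eqn 0) (eqn 1) (eqn 2) (eqn 3) (eqn 4).
  rewrite !(Qout 0, Qout 1, Qout 5, Qout 6) // !(addbF, addFb).
  have [k_in|] := boolP (k \in [:: v 2; v 3; v 4]); last first.
    rewrite !inE !negb_or => /and3P[k2 k3 k4] _ _ _ _ _.
    have -> : gen G j k = (false, false).
      by rewrite /gen -v3 G_ring nv pv (negPf k2) (negPf k3) (negPf k4).
    by rewrite if_same; apply: Qout0; rewrite -v3 ?nv ?pv.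
  have -> : gen G j k = (k == v 3, k != v 3).
    rewrite /gen -v3 G_ring nv pv; move: k_in; rewrite !inE.
    case/or3P => /eqP->; rewrite ?eqxx ?orbT ?(eq_sym (v 4)) ?(eq_sym (v 3) (v 2));
    by rewrite ?(negPf n23) ?(negPf n34).
  rewrite -v3; move: k_in; rewrite !inE.
  case/or3P=> /eqP->; rewrite ?eqxx ?(negPf n23) ?[v 4 == _]eq_sym ?(negPf n34);
  by case: (Q (v 2)) (Q (v 3)) (Q (v 4)) => [[] []] [[] []] [[] []].
case: (Q j).1 QE => QE; [left|right] => k.
  by rewrite -QE component_measured.
have := QE k; rewrite /Q /component; case: ifP => // _.
by case: (mu1 k).
Qed.

Lemma odd_ring_not_splits mu1 mu2 : odd n -> (forall v, iter n nxt v = v) ->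
  'I_n -> ~ splits G mu1 mu2.
Proof.
move=> n_odd iter_n v0 sp.
have G_nxt v : G v (nxt v) by rewrite G_ring eqxx.
have neq : forall j, mu1 j != mu2 j.
  by apply: splits_neq sp => v; exists (nxt v).
(* This color records whether [mu1] measures S_v. One setting cannot measure S_v and its successor,
   as it would need both Z and X on the latter qubit; so the color alternates, and an odd number of
   steps around the ring is contradictory. *)
pose c v := mu1 v == PauliX.
have mX mu v : measured mu (gen G v) -> mu v = PauliX /\ mu (nxt v) = PauliZ.
  move=> m; have := m v; have := m (nxt v); rewrite /gen G_nxt adj_irr eqxx.
  have -> : (nxt v == v) = false 
    by apply: negPf; exact: (nxt_acyclic v (isT : 0 < 1 < 5)%N).
  by case: (mu v) (mu (nxt v)) => [] [].
have cS v : c (nxt v) = ~~ c v.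
  have ZX : (PauliZ == PauliX) = false by apply/eqP.
  rewrite /c; have [/mX[-> ->]|/mX[m2v m2n]] := ring_component v neq sp.
    by rewrite ZX eqxx.
  have -> : (mu1 v == PauliX) = false by rewrite -m2v; apply: negPf.
  have [/mX[-> _]|/mX[m2n' _]] := ring_component (nxt v) neq sp.
    by rewrite eqxx.
  by rewrite m2n' in m2n.
have cn m v : c (iter m nxt v) = odd m (+) c v.
  by elim: m => //= m IH; rewrite cS IH addNb.
by have := cn n v0; rewrite iter_n n_odd; case: (c v0).
Qed.

End Ring.

Lemma odd_ring_graph_not_splits n (G : sgraph n) mu1 mu2 :
  (5 <= n)%N -> odd n -> is_ring_graph G -> ~ splits G mu1 mu2.
Proof.
move=> n5 n_odd [s sP].
pose nxt v := s (ordS ((s^-1)%g v)); pose prv v := s (ord_pred ((s^-1)%g v)).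
have nxtK : cancel nxt prv by move=> v; rewrite /nxt /prv permK ordSK permKV.
have prvK : cancel prv nxt by move=> v; rewrite /nxt /prv permK ord_predK permKV.
(* In the coordinates given by the inverse of [s], [nxt] adds 1 modulo n: fewer than n steps never
   close up, and n steps always do. *)
have iterE m v : val ((s^-1)%g (iter m nxt v)) = ((s^-1)%g v + m) %% n.
  elim: m => [|m IH] /=; first by rewrite addn0 modn_small.
  by rewrite /nxt permK /= IH -addn1 modnDml addn1 addnS.
apply: (odd_ring_not_splits (nxt := nxt) (prv := prv)) => //.
- move=> u v; rewrite -[u](permKV s) -[v](permKV s) sP /nxt /prv !permK.
  rewrite !(inj_eq perm_inj); congr (_ || _).
  by apply/eqP/eqP => [->|->]; rewrite ?ordSK ?ord_predK.
- move=> m v /andP[m0 m5]; apply/eqP => /(congr1 (fun w => val ((s^-1)%g w))).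
  have lt_vn := ltn_ord ((s^-1)%g v).
  rewrite iterE /=; have mn : (m < n)%N by exact: leq_trans m5 n5.
  have [lt|ge] := ltnP ((s^-1)%g v + m) n.
    by rewrite modn_small // => /eqP; rewrite -[X in _ == X]addn0 eqn_add2l;
       case: m m0 {m5 mn iterE lt}.
  rewrite -(subnK ge) modnDr modn_small; last first.
    rewrite ltn_subLR //; apply: leq_ltn_trans (leq_add (ltnW lt_vn) (leqnn m)) _.
    by rewrite ltn_add2l.
  by move/eqP; rewrite -(eqn_add2r n) subnK // eqn_add2l => /eqP e; rewrite e ltnn in mn.
- move=> v; apply: (@perm_inj _ s^-1%g); apply: val_inj; rewrite iterE.
  by rewrite modnDr modn_small.
- by exists 0%N; exact: leq_trans n5.
Qed.

Lemma ring_colorable3 n (G : sgraph n) : is_ring_graph G -> colorable G 3.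
Proof.
(* Parities alternate along the ring, and the last vertex takes a third color to absorb the clash at
   the wrap-around. *)
case=> s sP; pose c (i : 'I_n) : 'I_3 := if i.+1 == n then 2%R else inord (odd i).
have cS i j : j = ordS i -> i != j -> c i != c j.
  move=> -> nij; have lt_in := ltn_ord i.
  have [i_n|i_n] := eqVneq i.+1 n.
    have o0 : ordS i = 0%N :> nat by rewrite /= i_n modnn.
    (* The wrap-around leads back to the last vertex itself only for n = 1, which [nij] excludes. *)
    rewrite /c i_n eqxx o0; case: ifP => [/eqP n1|_]; last first.
      by rewrite -val_eqE /= inordK.
    case/eqP: nij; apply: val_inj; apply: (etrans _ (esym o0)).
    by apply: succn_inj; rewrite i_n -n1.
  have oS : ordS i = i.+1 :> nat by rewrite /= modn_small // ltn_neqAle i_n.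
  rewrite /c oS (negPf i_n); case: ifP => _; rewrite -val_eqE /= ?inordK //;
  by case: (odd i).
exists (fun v => c ((s^-1)%g v)) => u v.
rewrite -{1}[u](permKV s) -{1}[v](permKV s) => Guv.
have nuv : (s^-1)%g u != (s^-1)%g v.
  by apply/eqP => e; rewrite e adj_irr in Guv.
move: Guv; rewrite sP => /orP[] /eqP e; first exact: cS.
by rewrite eq_sym; apply: cS => //; rewrite eq_sym.
Qed.

(** * Chromatic numbers along the local complementation orbit *)

Section Chromatic.
Variable n : nat.
Implicit Type G : sgraph n.

Lemma colorableW G k m : (k <= m)%N -> colorable G k -> colorable G m.
Proof.
move=> km [c cP]; exists (fun i => widen_ord km (c i)) => i j /cP.
by rewrite -(inj_eq val_inj).
Qed.

(** The identity coloring with n colors shows that the minimum is attained and is not a default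
    value. *)
Lemma chromatic_number_colorable G : colorable G (chromatic_number G).
Proof.
suff /minimum_spec[] : colorable G n by [].
by exists id => i j Gij; apply/eqP => e; rewrite e adj_irr in Gij.
Qed.

Hypotheses (n_ge5 : (5 <= n)%N) (n_odd : odd n).

Lemma ring_LC_orbit_chromatic G js : is_ring_graph G ->
  (2 < chromatic_number (foldl (@local_complement n) G js))%N.
Proof.
move=> ringG; rewrite ltnNge; apply/negP.
move=> /colorableW/(_ (chromatic_number_colorable _)).
case=> c /colorable2_splits/LC_orbit_splits[mu1 [mu2]].
exact: odd_ring_graph_not_splits.
Qed.

Lemma ring_chromatic_number G : is_ring_graph G -> chromatic_number G = 3.
Proof.
move=> ringG; apply/eqP; rewrite eqn_leq (ring_LC_orbit_chromatic [::] ringG) andbT.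
exact/minimum_le/ring_colorable3.
Qed.

Lemma ring_LC_chromatic_number G : is_ring_graph G -> LC_chromatic_number G = 3.
Proof.
move=> ringG; apply: minimumP; first by exists [::]; apply: ring_chromatic_number.
by move=> m [js <-]; apply: ring_LC_orbit_chromatic.
Qed.

End Chromatic.

(** * Tensor products of Pauli matrices *)

Local Open Scope ring_scope.
Local Open Scope sesquilinear_scope.

Lemma neq_ffun (I : finType) (T : eqType) (f g : {ffun I -> T}) :
  f != g -> exists i, f i != g i.
Proof.
move=> nfg; apply/existsP; apply: contraNT nfg; rewrite negb_exists => /forallP e.
by apply/eqP/ffunP => i; apply/eqP; rewrite -[_ == _]negbK e.
Qed.

Section Tensor.
Variables (C : numClosedFieldType) (n : nat).
Implicit Types A B : 'I_n -> 'M[C]_2.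

Lemma eq_tensor A B : A =1 B -> tensor A = tensor B.
Proof. by move=> /funext->. Qed.

Lemma tensorM A B : tensor A *m tensor B = tensor (fun j => A j *m B j).
Proof.
apply/matrixP => a b; rewrite !mxE.
under [RHS]eq_bigr do rewrite mxE.
rewrite bigA_distr_bigA /= (reindex (fun i : 'I_#|{: bits n}| => enum_val i)) /=; last first.
  exact/onW_bij/enum_val_bij.
by apply: eq_bigr => c _; rewrite !mxE -big_split.
Qed.

Lemma tensor1 : tensor (fun=> 1%:M) = 1%:M :> operator C n.
Proof.
apply/matrixP => a b; rewrite !mxE -(inj_eq enum_val_inj).
have [->|nab] := eqVneq; first by rewrite big1 // => j _; rewrite mxE eqxx.
have [j nj] := neq_ffun nab.
by rewrite (bigD1 j) //= mxE (negPf nj) mul0r.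
Qed.

Lemma tensorZ (c : 'I_n -> C) A :
  tensor (fun j => c j *: A j) = (\prod_j c j) *: tensor A.
Proof.
apply/matrixP => a b; rewrite !mxE -big_split.
by apply: eq_bigr => j _; rewrite mxE.
Qed.

Lemma tensor_adj A : (tensor A)^t* = tensor (fun j => (A j)^t*).
Proof.
apply/matrixP => a b; rewrite !mxE rmorph_prod.
by apply: eq_bigr => j _; rewrite !mxE.
Qed.

Lemma tensor_sum (T : finType) (A : 'I_n -> T -> 'M[C]_2) :
  tensor (fun j => \sum_t A j t) =
  \sum_(f : {ffun 'I_n -> T}) tensor (fun j => A j (f j)).
Proof.
apply/matrixP => a b; rewrite !mxE summxE.
under eq_bigr do rewrite summxE.
by rewrite bigA_distr_bigA; apply: eq_bigr => f _; rewrite mxE.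
Qed.

(* The Hermitian representative of the phase class encoded by p. *)
Definition sigma (p : bool * bool) : 'M[C]_2 :=
  if p == (false, false) then 1%:M else pauli_mx C (vec_pauli p).

Lemma sigma_pauli_vec p : sigma (pauli_vec p) = pauli_mx C p.
Proof. by case: p. Qed.

Lemma sigma_adj p : (sigma p)^t* = sigma p.
Proof.
rewrite /sigma; case: ifP => _; last exact: pauli_mx_hermitian.
by apply/matrixP => i j; rewrite !mxE rmorph_nat eq_sym.
Qed.

Lemma sigmaK p : sigma p *m sigma p = 1%:M.
Proof. by rewrite /sigma; case: ifP => _; rewrite ?pauli_mxK ?mulmx1. Qed.

Lemma sigma_comm p q : sigma p *m sigma q = (-1) ^+ sympl p q *: (sigma q *m sigma p).
Proof.
case: (p =P q) => [->|npq]; first by rewrite /sympl andbC addbb scale1r.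
case: p q npq => [[] []] [[] []] // _;
  rewrite /sigma /sympl /= ?mulmx1 ?mul1mx ?scale1r // scaleN1r;
  apply/matrixP => -[[|[|//]] ?] [[|[|//]] ?];
  rewrite !mxE !big_ord_recr !big_ord0 /= !mxE /=;
  rewrite ?(mulr0, mul0r, mulr1, mul1r, addr0, add0r, sub0r, subr0, oppr0) //;
  by rewrite ?(mulrN1, mulN1r, mulNr, mulrN, opprK, addr0, add0r, subr0, oppr0, mulr1).
Qed.

Definition pauli_op (P : 'I_n -> bool * bool) : operator C n :=
  tensor (fun j => sigma (P j)).

Lemma pauli_op_adj P : (pauli_op P)^t* = pauli_op P.
Proof. by rewrite tensor_adj; apply: eq_tensor => j; apply: sigma_adj. Qed.

Lemma pauli_opK P : pauli_op P *m pauli_op P = 1%:M.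
Proof. by rewrite tensorM -tensor1; apply: eq_tensor => j; apply: sigmaK. Qed.

Lemma pauli_op_comm P Q :
  pauli_op P *m pauli_op Q = (-1) ^+ omega P Q *: (pauli_op Q *m pauli_op P).
Proof.
rewrite !tensorM (eq_tensor (fun j => sigma_comm (P j) (Q j))) tensorZ.
congr (_ *: _); rewrite /omega; elim/big_rec2: _ => // j b x _ ->.
by rewrite signr_addb.
Qed.

(** Written as a sum over [b] so that [tensor_sum] expands an outcome projector over subsets of
    qubits, that is, over the strings measured by the setting. *)
Lemma pauli_projE_sigma p (v : 'I_2) : pauli_proj C p v =
  \sum_(b : bool) (2^-1 * (-1) ^+ (b * v)%N) *:
    sigma (if b then pauli_vec p else (false, false)).
Proof.
rewrite big_bool sigma_pauli_vec pauli_projE scalerDr scalerA mul1n addrC.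
by rewrite /sigma eqxx mul0n expr0 mulr1.
Qed.

Section Outcomes.
Variable mu : setting n.

Definition sub_setting (f : {ffun 'I_n -> bool}) : 'I_n -> bool * bool :=
  fun j => if f j then pauli_vec (mu j) else (false, false).

Lemma sub_setting_measured f : measured mu (sub_setting f).
Proof. by move=> j; rewrite /sub_setting; case: (f j); case: (mu j). Qed.

Lemma outcome_projE v : outcome_proj C mu v =
  \sum_(f : {ffun 'I_n -> bool})
    (\prod_j (2^-1 * (-1) ^+ (f j * v j)%N)) *: pauli_op (sub_setting f).
Proof.
rewrite /outcome_proj (eq_tensor (fun j => pauli_projE_sigma (mu j) (v j))).
by rewrite tensor_sum; apply: eq_bigr => f _; rewrite tensorZ.
Qed.

Lemma pauli_proj_adj p (v : 'I_2) : (pauli_proj C p v)^t* = pauli_proj C p v.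
Proof.
rewrite pauli_projE; apply/matrixP => i j; rewrite !mxE.
rewrite rmorphM rmorphD rmorphM /= rmorph_sign fmorphV !rmorph_nat.
by rewrite -[in RHS]pauli_mx_hermitian !mxE (eq_sym j).
Qed.

Lemma pauli_proj_mx p (v : 'I_2) :
  pauli_proj C p v *m pauli_mx C p = (-1) ^+ v *: pauli_proj C p v.
Proof.
rewrite pauli_projE -scalemxAl mulmxDl mul1mx -scalemxAl pauli_mxK.
rewrite scalerA [_ * 2^-1]mulrC -scalerA; congr (_ *: _).
by rewrite scalerDr scalerA -expr2 sqrr_sign scale1r addrC.
Qed.

Lemma pauli_projM p (v w : 'I_2) :
  pauli_proj C p v *m pauli_proj C p w = (v == w)%:R *: pauli_proj C p v.
Proof.
rewrite [X in _ *m X]pauli_projE -scalemxAr mulmxDr mulmx1 -scalemxAr pauli_proj_mx.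
rewrite scalerA -[X in X + _]scale1r -scalerDl scalerA.
case: (v =P w) => [->|nvw].
  by rewrite -expr2 sqrr_sign mulVf ?scale1r // pnatr_eq0.
rewrite (_ : (-1) ^+ w * (-1) ^+ v = -1) ?subrr ?mulr0 ?scale0r //.
case: v w nvw => [[|[|//]] ?] [[|[|//]] ?] nvw; rewrite ?mul1r ?mulr1 //=;
by case: nvw; apply: val_inj.
Qed.

Lemma pauli_proj_sum p : \sum_v pauli_proj C p v = 1%:M.
Proof.
rewrite !big_ord_recr big_ord0 /= add0r !pauli_projE -scalerDr /= expr0 expr1.
rewrite addrACA scale1r scaleN1r subrr addr0 -mulr2n -scaler_nat scalerA.
by rewrite mulVf ?pnatr_eq0 // scale1r.
Qed.

Lemma outcome_proj_adj v : (outcome_proj C mu v)^t* = outcome_proj C mu v.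
Proof. by rewrite tensor_adj; apply: eq_tensor => j; apply: pauli_proj_adj. Qed.

Lemma outcome_projM v w :
  outcome_proj C mu v *m outcome_proj C mu w = (v == w)%:R *: outcome_proj C mu v.
Proof.
rewrite tensorM (eq_tensor (fun j => pauli_projM (mu j) (v j) (w j))) tensorZ.
congr (_ *: _); have [->|nvw] := eqVneq v w.
  by rewrite big1 // => j _; rewrite eqxx.
have [j nj] := neq_ffun nvw.
by rewrite (bigD1 j) //= (negPf nj) mul0r.
Qed.

Lemma outcome_proj_sum : \sum_v outcome_proj C mu v = 1%:M.
Proof.
rewrite -tensor1 -(eq_tensor (fun j => pauli_proj_sum (mu j))).
by rewrite tensor_sum.
Qed.

Lemma outcome_sub_setting f v :
  outcome_proj C mu v *m pauli_op (sub_setting f) =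
  (\prod_j (-1) ^+ (f j * v j)%N) *: outcome_proj C mu v.
Proof.
rewrite tensorM -tensorZ; apply: eq_tensor => j; rewrite /sub_setting.
case: (f j); first by rewrite sigma_pauli_vec pauli_proj_mx mul1n.
by rewrite /sigma eqxx mulmx1 mul0n expr0 scale1r.
Qed.

End Outcomes.

End Tensor.

(** * Two settings do not suffice *)

Section Spectrum.
Variable C : numClosedFieldType.

Lemma adjmxM m n p (A : 'M[C]_(m, n)) (B : 'M[C]_(n, p)) :
  (A *m B)^t* = B^t* *m A^t*.
Proof. by rewrite trmx_mul map_mxM. Qed.

Lemma adjmxZ m n (c : C) (A : 'M[C]_(m, n)) : (c *: A)^t* = c^* *: A^t*.
Proof. by rewrite linearZ /= map_mxZ. Qed.

Lemma mx_eqN_eq0 m n (x : 'M[C]_(m, n)) : x = - x -> x = 0.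
Proof.
move=> xN; have /eqP : (2 : C) *: x = 0 by rewrite scaler_nat mulr2n {1}xN addNr.
by rewrite scaler_eq0 pnatr_eq0 => /eqP.
Qed.

Lemma adjmx_self_eq0 m (x : 'cV[C]_m) : x^t* *m x = 0 -> x = 0.
Proof.
move=> /matrixP/(_ 0 0); rewrite !mxE => /eqP.
rewrite psumr_eq0 => [/allP x0|i _]; last by rewrite !mxE mulrC mul_conjC_ge0.
apply/matrixP => i j; rewrite ord1 !mxE; have := x0 i (mem_index_enum _).
by rewrite /= !mxE mulrC mul_conjC_eq0 => /eqP.
Qed.

(** Multiplication by [P] carries one characteristic matrix to the other; the nonzero determinant of
    [P] then cancels. *)
Lemma char_poly_diagonalized m (A P : 'M[C]_m) (d : 'rV[C]_m) :
  P \in unitmx -> A *m P = P *m diag_mx d ->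
  char_poly A = \prod_i ('X - (d 0 i)%:P).
Proof.
move=> uP AP; rewrite (_ : \prod_i _ = char_poly (diag_mx d)); last first.
  rewrite char_poly_trig ?diag_mx_is_trig //.
  by apply: eq_bigr => i _; rewrite mxE eqxx.
have dP : \det (map_mx polyC P) != 0.
  by rewrite det_map_mx polyC_eq0 -unitfE -unitmxE.
apply: (mulIf dP); rewrite [RHS]mulrC -!det_mulmx; congr (\det _).
rewrite /char_poly_mx mulmxBl mulmxBr -!map_mxM AP; congr (_ - _).
by rewrite scalar_mxC.
Qed.

(** A second eigenvalue below 1 leaves a single index with eigenvalue 1. In the eigenbasis both
    fixed vectors are supported on that index, so their inner product cannot vanish. *)
Lemma second_eigenvalue_multiplicity n (A : operator C n) (x y : ket C n) :
  A \is hermsymmx -> A *m x = x -> A *m y = y -> x != 0 -> y != 0 ->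
  x^t* *m y = 0 -> ~ second_eigenvalue_lt1 A.
Proof.
move=> /hermitian_normalmx/orthomx_spectralP.
set P := spectralmx A; set d := spectral_diag A => AE Ax Ay x0 y0 xy [s [As s_sorted] s1].
have uP : P \in unitmx by exact: spectral_unit.
have PP : P^t* *m P = 1%:M.
  by rewrite -(invmx_unitary (spectral_unitarymx A)) mulVmx.
have perm_s : perm_eq s [seq d 0 i | i <- enum 'I_#|{: bits n}|].
  apply: prod_XsubC_eq; rewrite -As big_map big_enum /=.
  apply: (@char_poly_diagonalized _ _ (invmx P)); first by rewrite unitmx_inv.
  by rewrite AE mulmxK.
have d1_uniq i j : d 0 i = 1 -> d 0 j = 1 -> i = j.
  (* By sortedness, an occurrence of 1 behind the head of [s] would keep the second entry from being
     below 1. *)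
  have c1 : (count_mem 1%R s <= 1)%N.
    case: s s_sorted s1 {As perm_s} => //= a s s_sorted s1.
    suff -> : count_mem 1 s = 0%N by rewrite addn0; case: (a == 1).
    apply/count_memPn; apply/negP => s_1; case: s s_1 s_sorted s1 => // b s.
    rewrite inE /= => /orP[/eqP<-|s_1]; first by rewrite ltxx.
    move=> /andP[_]; rewrite (path_sortedE ge_trans).
    move=> /andP[/allP/(_ _ s_1) /= b1 _] b_lt.
    by have := le_lt_trans b1 b_lt; rewrite ltxx.
  move=> di dj; apply: contraTeq c1 => nij.
  rewrite (seq.permP perm_s) count_map -size_filter -ltnNge.
  apply: (@uniq_leq_size _ [:: i; j]); first by rewrite /= inE nij.
  move=> k; rewrite !inE mem_filter mem_enum /= andbT => /orP[] /eqP->.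
    by rewrite di.
  by rewrite dj.
have supp (z : ket C n) : A *m z = z -> z != 0 -> exists2 i,
    (P *m z) i 0 != 0 & d 0 i = 1 /\ forall j, j != i -> (P *m z) j 0 = 0.
  move=> Az z0; pose w := P *m z.
  have dw j : w j 0 != 0 -> d 0 j = 1.
    have : P *m (A *m z) = w by rewrite Az.
    rewrite [in A *m z]AE !mulmxA mulmxV // mul1mx -mulmxA -/w.
    move=> /matrixP/(_ j 0); rewrite mul_diag_mx mxE => e wj.
    by apply: (mulIf wj); rewrite e mul1r.
  have [i wi] : exists i, w i 0 != 0.
    apply/existsP; apply: contraNT z0; rewrite negb_exists => /forallP w0.
    suff w00 : w = 0 by rewrite -[z](mulKmx uP) -/w w00 mulmx0.
    by apply/colP => k; rewrite [RHS]mxE; apply/eqP; rewrite -[_ == _]negbK w0.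
  exists i => //; split; first exact: dw.
  move=> j nji; apply/eqP; apply: contraNT nji => wj.
  by apply/eqP/d1_uniq; apply: dw.
have [i xi [di x_i]] := supp x Ax x0; have [j yj [dj y_j]] := supp y Ay y0.
have eij := d1_uniq _ _ di dj; subst j.
have : (P *m x)^t* *m (P *m y) = 0.
  by rewrite adjmxM mulmxA -[_ *m P^t* *m P]mulmxA PP mulmx1.
move: (P *m x) (P *m y) xi yj y_j => u w ui wi w_i /matrixP/(_ 0 0).
rewrite !mxE (bigD1 i) //= big1 => [/eqP|k nk]; last by rewrite w_i ?mulr0.
by rewrite addr0 !mxE mulf_eq0 conjC_eq0 (negPf ui) (negPf wi).
Qed.

End Spectrum.

Lemma outcome_norm (C : numClosedFieldType) n (mu : setting n) v (x : ket C n) :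
  (outcome_proj C mu v *m x)^t* *m (outcome_proj C mu v *m x) =
  x^t* *m outcome_proj C mu v *m x.
Proof.
rewrite adjmxM outcome_proj_adj mulmxA -[_ *m _ *m outcome_proj _ _ _]mulmxA.
by rewrite outcome_projM eqxx scale1r.
Qed.

(** * Pauli strings and test operators acting on a graph state *)

Section GraphStates.
Variables (C : numClosedFieldType) (n : nat) (G : sgraph n).

Lemma prod_pauli_at (p : pauli) (r : seq 'I_n) (S : pred 'I_n) : uniq r ->
  \prod_(k <- r | S k) (pauli_at C p k) =
  tensor (fun i => if (i \in r) && S i then pauli_mx C p else 1%:M) :> operator C n.
Proof.
elim: r => [|a r IH] /=; first by rewrite big_nil tensor1.
move=> /andP[a_r /IH{}IH]; rewrite big_cons IH; case: ifP => Sa.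
  rewrite -mulmxE tensorM; apply: eq_tensor => i; rewrite inE.
  have [->|_] := eqVneq i a; last by rewrite mul1mx.
  by rewrite (negPf a_r) Sa mulmx1.
apply: eq_tensor => i; rewrite inE.
by have [->|] := eqVneq i a; rewrite // (negPf a_r) Sa.
Qed.

Lemma stabilizerE j : stabilizer C G j = pauli_op C (gen G j).
Proof.
rewrite /stabilizer prod_pauli_at ?index_enum_uniq // -mulmxE tensorM.
apply: eq_tensor => k; rewrite mem_index_enum /= /sigma /gen.
have [->|_] := eqVneq k j; first by rewrite adj_irr mulmx1.
by case: (G j k); rewrite mul1mx.
Qed.

Variable psi : ket C n.
Hypothesis psi_state : is_graph_state G psi.

Lemma pauli_op_gen j : pauli_op C (gen G j) *m psi = psi.
Proof. by rewrite -stabilizerE; have [_] := psi_state. Qed.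

(** Moving a generator that fixes [psi] past an anticommuting [P] shows that the expectation is its
    own negative. *)
Lemma pauli_expectation0 P : ~ centralizes G P ->
  psi^t* *m pauli_op C P *m psi = 0.
Proof.
move=> /existsNP[k] /eqP; rewrite eqbF_neg negbK => anti.
apply: mx_eqN_eq0.
have pS : psi^t* *m pauli_op C (gen G k) = psi^t*.
  by rewrite -[in RHS](pauli_op_gen k) adjmxM pauli_op_adj.
rewrite -{2}(pauli_op_gen k) !mulmxA -[_ *m pauli_op C P *m _]mulmxA.
by rewrite pauli_op_comm anti expr1 scaleN1r mulmxN mulNmx !mulmxA pS.
Qed.

Lemma pauli_image_norm P : (pauli_op C P *m psi)^t* *m (pauli_op C P *m psi) = 1%:M.
Proof.
rewrite adjmxM pauli_op_adj -mulmxA [pauli_op _ _ *m (_ *m _)]mulmxA pauli_opK mul1mx.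
by have [] := psi_state.
Qed.

(** [psi] and its image under [Q] have the same outcome probabilities: in the expansion of the
    projector, stabilizer strings commute with [Q], and all other strings have expectation 0. *)
Lemma pauli_conj_outcome mu v Q :
  (forall P, centralizes G P -> measured mu P -> omega P Q = false) ->
  psi^t* *m (pauli_op C Q *m outcome_proj C mu v *m pauli_op C Q) *m psi =
  psi^t* *m outcome_proj C mu v *m psi.
Proof.
move=> QP; rewrite outcome_projE mulmx_sumr !mulmx_suml !mulmx_sumr !mulmx_suml.
apply: eq_bigr => f _; rewrite -!(scalemxAl, scalemxAr); congr (_ *: _).
set P := sub_setting mu f; have [cP|ncP] := pselect (centralizes G P).
  rewrite pauli_op_comm omegaC (QP _ cP (sub_setting_measured _ _)) scale1r.
  by rewrite -mulmxA pauli_opK mulmx1.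
rewrite pauli_op_comm -scalemxAl -mulmxA pauli_opK mulmx1.
by rewrite -!(scalemxAl, scalemxAr) pauli_expectation0 ?scaler0.
Qed.

(** [E] has coefficient 1 on each outcome that [psi] can produce, and the image of [psi] under [Q]
    produces no other outcomes. *)
Lemma test_operator_pauli_fixed mu E Q : test_operator psi mu E ->
  (forall P, centralizes G P -> measured mu P -> omega P Q = false) ->
  E *m (pauli_op C Q *m psi) = pauli_op C Q *m psi.
Proof.
move=> [_ _ Epsi [c EE]] QP; set phi := _ *m psi.
have c1 v : c v *: (outcome_proj C mu v *m psi) = outcome_proj C mu v *m psi.
  rewrite -{2}Epsi EE mulmxA mulmx_sumr (bigD1 v) //= big1 => [|w nw].
    by rewrite addr0 -scalemxAr outcome_projM eqxx scale1r scalemxAl.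
  by rewrite -scalemxAr outcome_projM eq_sym (negPf nw) scale0r scaler0.
rewrite {1}EE mulmx_suml -[RHS]mul1mx -(outcome_proj_sum C mu) mulmx_suml.
apply: eq_bigr => v _; rewrite -scalemxAl.
have [psi_v|psi_v] := eqVneq (outcome_proj C mu v *m psi) 0.
  suff -> : outcome_proj C mu v *m phi = 0 by rewrite scaler0.
  apply: adjmx_self_eq0; rewrite outcome_norm /phi adjmxM pauli_op_adj.
  rewrite -[RHS](mulmx0 _ (psi^t*)) -psi_v [in RHS]mulmxA -(pauli_conj_outcome v QP).
  by rewrite !mulmxA.
have /eqP := c1 v; rewrite -{2}[_ *m psi]scale1r -subr_eq0 -scalerBl scaler_eq0.
by rewrite (negPf psi_v) orbF subr_eq0 => /eqP->; rewrite scale1r.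
Qed.

End GraphStates.

Lemma few_settings_splits (C : numClosedFieldType) n (G : sgraph n) M :
  can_verify C G M -> (#|M| <= 2)%N -> exists mu1 mu2, splits G mu1 mu2.
Proof.
move=> [psi [psiG [p [E [p_ge0 p_sum1 tests second]]]]] M2.
(* [M] is nonempty because the weights sum to 1; for a singleton the two settings coincide. *)
have [mu1 [mu2 M12]] : exists mu1 mu2, forall mu, mu \in M -> mu = mu1 \/ mu = mu2.
  have [M0|[mu1 M1]] := set_0Vmem M.
    by move: p_sum1; rewrite M0 big_set0 => /eqP; rewrite eq_sym oner_eq0.
  exists mu1; have [M0|[mu2 M2']] := set_0Vmem (M :\ mu1).
    exists mu1 => mu Mmu; left; apply/eqP; apply: contraT => nmu.
    by have := finset.in_set0 mu; rewrite -M0 !inE nmu Mmu.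
  exists mu2 => mu Mmu; have [->|n1] := eqVneq mu mu1; [by left|right].
  have /card_le1_eqP le1 : (#|M :\ mu1| <= 1)%N by move: M2; rewrite (cardsD1 mu1) M1.
  by apply: le1 => //; rewrite !inE n1.
exists mu1, mu2 => Q QP; apply: contrapT => ncQ.
pose Omega := \sum_(mu in M) p mu *: E mu.
have fixed phi : (forall mu, mu \in M -> E mu *m phi = phi) -> Omega *m phi = phi.
  move=> Ephi; rewrite /Omega mulmx_suml -[RHS]scale1r -p_sum1 scaler_suml.
  by apply: eq_bigr => mu Mmu; rewrite -scalemxAl Ephi.
have nz (x : ket C n) : x^t* *m x = 1%:M -> x != 0.
  move=> xx; apply/eqP => x0; move: xx; rewrite x0 mulmx0 => /matrixP/(_ 0 0).
  by rewrite !mxE => /eqP; rewrite eq_sym oner_eq0.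
apply: (second_eigenvalue_multiplicity (x := psi) (y := pauli_op C Q *m psi)
  _ _ _ _ _ _ second).
- apply/is_hermitianmxP; rewrite expr0 scale1r linear_sum raddf_sum.
  apply: eq_bigr => mu Mmu; have [[/is_hermitianmxP + _] _ _ _] := tests mu Mmu.
  rewrite expr0 scale1r => {1}->; rewrite /= adjmxZ; congr (_ *: _).
  exact/esym/geC0_conj/p_ge0.
- by apply: fixed => mu /tests[].
- apply: fixed => mu Mmu; apply: (test_operator_pauli_fixed psiG (tests _ Mmu)).
  by move=> P cP mP; apply: QP => //; have [<-|<-] := M12 _ Mmu; [left|right].
- by apply: nz; have [] := psiG.
- by apply: nz; apply: (pauli_image_norm psiG).
- by rewrite mulmxA; apply: (pauli_expectation0 psiG).
Qed.

(** * Verification by a coloring *)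

Section Existence.
Variables (C : numClosedFieldType) (n : nat) (G : sgraph n).

(* The amplitude of the bit string x in the graph state is (-1)^(number of
   edges inside the support of x), up to normalisation. *)
Definition edge_parity (x : 'I_n -> bool) : bool :=
  \big[addb/false]_(i < n) \big[addb/false]_(k < n)
    [&& (i < k)%N, G i k, x i & x k].

(** Flipping bit [j] adds or removes exactly the edges from [j] to its neighbors in the support. *)
Lemma edge_parity_flip x j :
  edge_parity (fun k => x k (+) (k == j)) =
  \big[addb/false]_k (G j k && x k) (+) edge_parity x.
Proof.
(* Each edge is oriented from its smaller to its larger endpoint and counted once; [pick] and
   [pick2] inflate single sums to double sums, so that the identity is checked term by term. *)
pose c (i k : 'I_n) := (i < k)%N && G i k.
have pick (F : 'I_n -> bool) : \big[addb/false]_i ((i == j) && F i) = F j.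
  by rewrite (bigD1 j) //= eqxx big1 ?addbF // => i /negPf->.
have pick2 (F : 'I_n -> 'I_n -> bool) :
    \big[addb/false]_i \big[addb/false]_k ((i == j) && F i k) =
    \big[addb/false]_k F j k.
  rewrite (bigD1 j) //= [X in _ (+) X]big1 ?addbF => [|i /negPf->]; last exact: big1.
  by apply: eq_bigr => k _; rewrite eqxx.
have cG k : G j k = c j k (+) c k j.
  rewrite /c (adj_sym G k j); case: (ltngtP j k) => [_|_|/val_inj->].
  - by case: (G j k).
  - by case: (G j k).
  - by rewrite adj_irr.
have -> : \big[addb/false]_k (G j k && x k) =
    \big[addb/false]_k (c j k && x k) (+) \big[addb/false]_i (c i j && x i).
  by rewrite -big_split; apply: eq_bigr => k _ /=; rewrite cG andb_addl.
rewrite -(pick2 (fun i k => c i k && x k)).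
under [X in _ (+) X (+) _]eq_bigr do rewrite -(pick (fun k => c _ k && x _)).
rewrite /edge_parity -!big_split; apply: eq_bigr => i _ /=.
rewrite -!big_split; apply: eq_bigr => k _ /=.
have cjj : c j j = false by rewrite /c ltnn.
have cE (u w : 'I_n) (b : bool) : (u < w)%N && (G u w && b) = c u w && b.
  by rewrite /c andbA.
rewrite !cE; move: (c) cjj => d djj.
have [->|nij] := eqVneq i j; have [->|nkj] := eqVneq k j.
- by rewrite djj.
- by case: (d j k) (x j) (x k) => [] [] [].
- by case: (d i j) (x i) (x j) => [] [] [].
- by case: (d i k) (x i) (x k) => [] [] [].
Qed.

(** The hypothesis excludes Y, so the entries are real: each row has one nonzero entry, a sign. *)
Lemma sigma_entry x z (u t : 'I_2) : x && z = false ->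
  sigma C (x, z) u t =
  if t == (if x then 1 - u else u) then (-1) ^+ (z && (u == 1)) else 0.
Proof.
case: x z u t => [] [] [[|[|//]] ?] [[|[|//]] ?] // _; rewrite /sigma /= !mxE //=;
by rewrite ?(addr0, add0r, sub0r, subr0, oppr0).
Qed.

Lemma graph_state_exists : exists psi : ket C n, is_graph_state G psi.
Proof.
pose bit (a : bits n) : 'I_n -> bool := fun k => a k == 1.
pose f : ket C n := \col_i (-1) ^+ edge_parity (bit (enum_val i)).
have ff : f^t* *m f = #|{: bits n}|%:R%:M.
  apply/matrixP => i j; rewrite !ord1 !mxE -[X in X%:R]card_ord -sumr_const.
  by apply: eq_bigr => k _; rewrite !mxE rmorph_sign -expr2 sqrr_sign.
have Sf j : pauli_op C (gen G j) *m f = f.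
  (* [b] is the bit string of [a] with bit [j] flipped, the only column in which this row of the
     generator is nonzero. *)
  apply/colP => a; rewrite mxE; pose b : bits n :=
    [ffun k => if k == j then 1 - enum_val a k else (enum_val a : bits n) k].
  have gen_xz k : (k == j) && G j k = false by case: eqP => // ->; rewrite adj_irr.
  rewrite (bigD1 (enum_rank b)) //= big1 => [|i nib]; last first.
    have [k nk] : exists k, (enum_val i : bits n) k != b k.
      by apply: neq_ffun; apply: contraNneq nib => <-; rewrite enum_valK.
    rewrite mxE (bigD1 k) //= sigma_entry //.
    by move: nk; rewrite ffunE => /negPf->; rewrite !mul0r.
  rewrite addr0 !mxE enum_rankK.
  under eq_bigr do rewrite sigma_entry // ffunE eqxx.
  have -> : edge_parity (bit b) =
      edge_parity (fun k => bit (enum_val a) k (+) (k == j)).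
    congr edge_parity; apply/funext => k; rewrite /bit ffunE.
    by case: (k == j); case: ((enum_val a : bits n) k) => [[|[|//]] ?].
  (* The Z factors of the generator produce the same sign as the change of [edge_parity], so the two
     cancel. *)
  rewrite edge_parity_flip signr_addb mulrA.
  suff -> : \prod_k (-1) ^+ (G j k && bit (enum_val a) k) =
      (-1) ^+ (\big[addb/false]_k (G j k && bit (enum_val a) k) : bool) :> C.
    by rewrite -signr_addb addbb mul1r.
  elim/big_rec2: _ => // k y1 y2 _ ->; first by rewrite signr_addb.
have N0 : (0 : C) < #|{: bits n}|%:R by rewrite ltr0n; apply/card_gt0P; exists 0.
exists ((sqrtC #|{: bits n}|%:R)^-1 *: f); split=> [|j].
  rewrite adjmxZ -scalemxAl -scalemxAr ff scalerA.
  rewrite fmorphV /= geC0_conj ?sqrtC_ge0 ?ltW // -invfM -expr2 sqrtCK.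
  by rewrite -scalemx1 scalerA mulVf ?scale1r // gt_eqF.
by rewrite -scalemxAr stabilizerE Sf.
Qed.

End Existence.

(** * Test projectors diagonal in the graph basis *)

Section Verification.
Variables (C : numClosedFieldType) (n : nat) (G : sgraph n).

Lemma psd_outcome mu (c : bits n -> C) : (forall v, 0 <= c v) ->
  psd (\sum_v c v *: outcome_proj C mu v).
Proof.
move=> c0; split.
  apply/is_hermitianmxP; rewrite expr0 scale1r linear_sum raddf_sum.
  by apply: eq_bigr => v _; rewrite /= adjmxZ outcome_proj_adj geC0_conj.
move=> x; rewrite mulmx_sumr mulmx_suml summxE; apply: sumr_ge0 => v _.
rewrite -scalemxAr -scalemxAl mxE mulr_ge0 //.
by rewrite -outcome_norm mxE; apply: sumr_ge0 => k _; rewrite !mxE mulrC mul_conjC_ge0.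
Qed.

(** The eigenvalues share a denominator, so they are sorted through their natural numerators, where
    the order is total. *)
Lemma second_eigenvalue_counts (A : operator C n) (m : 'I_#|{: bits n}| -> nat) i0 :
  char_poly A = \prod_i ('X - ((m i)%:R / (m i0)%:R)%:P) ->
  (0 < m i0)%N -> (forall i, i != i0 -> (m i < m i0)%N) ->
  second_eigenvalue_lt1 A.
Proof.
move=> AE m0 m_lt; set K := (m i0)%:R : C.
have K0 : 0 < K by rewrite ltr0n.
pose t := sort geq [seq m i | i <- enum 'I_#|{: bits n}| & i != i0].
have t_lt k : k \in t -> (k < m i0)%N.
  rewrite mem_sort => /mapP[i i_in ->]; apply: m_lt.
  by move: i_in; rewrite mem_filter => /andP[].
have geq_tr : transitive geq by move=> a b c ab bc; exact: leq_trans bc ab.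
exists [seq k%:R / K | k <- m i0 :: t]; last first.
  (* With a single eigenvalue the second entry is the default 0. *)
  rewrite /=; case: {geq_tr} t t_lt => [|k t] t_lt /=; first exact: ltr01.
  by rewrite ltr_pdivrMr // mul1r ltr_nat t_lt ?mem_head.
split.
  rewrite AE (bigD1 i0) //= big_cons; congr (_ * _).
  rewrite big_map (perm_big _ (permEl (perm_sort _ _))) /= big_map big_filter.
  by rewrite big_enum_cond.
rewrite sorted_map; apply: (@sub_sorted _ geq) => [a b /= ab|].
  by rewrite ler_wpM2r ?ler_nat // invr_ge0 ltW.
rewrite /= path_sortedE //; apply/andP; split.
  by apply/allP => k /t_lt/ltnW.
by apply: sort_sorted => a b; exact: leq_total.
Qed.

Definition zshift (w : bits n) : 'I_n -> bool * bool := fun j => (false, w j == 1).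

Variable psi : ket C n.
Hypothesis psi_state : is_graph_state G psi.

(* The graph basis: joint eigenvectors of the stabilizer generators. *)
Definition graph_basis (w : bits n) : ket C n := pauli_op C (zshift w) *m psi.

Lemma gen_graph_basis w j :
  pauli_op C (gen G j) *m graph_basis w = (-1) ^+ (w j == 1) *: graph_basis w.
Proof.
have -> : (w j == 1) = omega (gen G j) (zshift w).
  rewrite /omega (bigD1 j) //= big1 => [|k nk]; rewrite /sympl /gen /zshift /=.
    by rewrite eqxx andbF !addbF.
  by rewrite (negPf nk) andbF.
by rewrite /graph_basis mulmxA pauli_op_comm -scalemxAl -mulmxA (pauli_op_gen psi_state).
Qed.

(** If the bit strings differ at [j], the vectors have opposite eigenvalues for the unitary S_j, so
    their inner product is its own negative. *)
Lemma graph_basis_orthonormal w w' :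
  (graph_basis w)^t* *m graph_basis w' = (w == w')%:R%:M.
Proof.
have [<-|nww] := eqVneq w w'; first exact: (pauli_image_norm psi_state).
have [j nj] := neq_ffun nww.
rewrite /= mulr0n raddf0; apply: mx_eqN_eq0.
have iso (x y : ket C n) :
    (pauli_op C (gen G j) *m x)^t* *m (pauli_op C (gen G j) *m y) = x^t* *m y.
  by rewrite adjmxM pauli_op_adj mulmxA -[X in X *m y]mulmxA pauli_opK mulmx1.
rewrite -{1}iso !gen_graph_basis adjmxZ rmorph_sign -scalemxAl -scalemxAr scalerA.
rewrite -signr_addb (_ : _ (+) _ = true) ?scaleN1r //.
by case: (w j) (w' j) nj => [[|[|//]] ?] [[|[|//]] ?].
Qed.

Section Setting.
Variable mu : setting n.
Hypothesis mu_gen : forall j, mu j = PauliX -> measured mu (gen G j).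

Lemma gen_sub_setting j : mu j = PauliX ->
  gen G j = sub_setting mu [ffun k => (k == j) || G j k].
Proof.
move=> mj; apply/funext => k; have := mu_gen mj k.
rewrite /sub_setting /gen ffunE; have [->|_] := eqVneq k j; first by rewrite mj adj_irr.
by case: (G j k); case: (mu k).
Qed.

(** The value that outcome [v] gives to S_j when S_j is measured: the product of the signs on the
    closed neighborhood of [j], in the form produced by [outcome_sub_setting]. *)
Definition stab_sign j (v : bits n) : C :=
  \prod_k (-1) ^+ ([ffun k => (k == j) || G j k] k * v k)%N.

(* The projector onto the outcomes compatible with all the stabilizer
   generators that the setting measures. *)
Definition test_proj : operator C n :=
  \sum_v [forall j, (mu j == PauliX) ==> (stab_sign j v == 1)]%:R *: outcome_proj C mu v.

Definition passes (w : bits n) : bool := [forall j, (mu j == PauliX) ==> (w j != 1)].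

(** S_j inserted between projector and vector can be evaluated on either side, and the two signs
    must agree. *)
Lemma outcome_graph_basis j v w : mu j = PauliX ->
  outcome_proj C mu v *m graph_basis w != 0 -> stab_sign j v = (-1) ^+ (w j == 1).
Proof.
move=> mj; set y := _ *m _ => y0; apply/eqP; rewrite -subr_eq0.
suff /eqP : (stab_sign j v - (-1) ^+ (w j == 1)) *: y = 0.
  by rewrite scaler_eq0 (negPf y0) orbF.
rewrite scalerBl /y [X in _ - X]scalemxAr -gen_graph_basis.
by rewrite [X in _ - X]mulmxA (gen_sub_setting mj) outcome_sub_setting -scalemxAl subrr.
Qed.

(** Every outcome that the basis vector can produce shows the true signs of its measured generators,
    so all these outcomes are accepted or all are rejected. *)
Lemma test_proj_graph_basis w :
  test_proj *m graph_basis w = (passes w)%:R *: graph_basis w.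
Proof.
rewrite -{2}[graph_basis w]mul1mx -(outcome_proj_sum C mu) !mulmx_suml scaler_sumr.
apply: eq_bigr => v _; rewrite -scalemxAl.
have [->|nz] := eqVneq (outcome_proj C mu v *m graph_basis w) 0.
  by rewrite !scaler0.
congr (_%:R *: _); congr nat_of_bool; apply: eq_forallb => j.
case: (mu j =P PauliX) => //= mj; rewrite (outcome_graph_basis mj nz).
by case: (w j == 1); rewrite ?eqxx //= expr1 eqNr oner_eq0.
Qed.

Lemma test_proj_operator : test_operator psi mu test_proj.
Proof.
split; first by apply: psd_outcome => v; apply: ler0n.
- rewrite -(outcome_proj_sum C mu) /test_proj -sumrB.
  under eq_bigr do rewrite -[X in X - _]scale1r -scalerBl.
  by apply: psd_outcome => v; rewrite subr_ge0 lern1 leq_b1.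
(* [psi] is the graph basis vector of the zero string, which passes every test. *)
- have := test_proj_graph_basis 0; rewrite /graph_basis.
  have -> : pauli_op C (zshift 0) = 1%:M.
    by rewrite -tensor1; apply: eq_tensor => j; rewrite /zshift ffunE.
  rewrite mul1mx (_ : passes 0 = true) ?scale1r //.
  by apply/forallP => j; rewrite ffunE implybT.
- by eexists.
Qed.

End Setting.

(** In the uniform mixture of the test projectors, the eigenvalue at the basis vector of [w] is the
    fraction of settings that [w] passes. *)
Lemma settings_verify (M : {set setting n}) : (0 < #|M|)%N ->
  (forall mu j, mu \in M -> mu j = PauliX -> measured mu (gen G j)) ->
  (forall j, exists2 mu, mu \in M & mu j = PauliX) ->
  can_verify C G M.
Proof.
move=> M0 M_gen M_cover; exists psi; split=> //.
exists (fun=> #|M|%:R^-1), test_proj; split.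
- by move=> mu _; rewrite invr_ge0 ler0n.
- by rewrite sumr_const -[_ *+ _]mulr_natl mulfV // pnatr_eq0 -lt0n.
- by move=> mu Mmu; apply: test_proj_operator => j; apply: M_gen.
set Omega := \sum_(mu in M) _.
pose m (i : 'I_#|{: bits n}|) := #|[set mu in M | passes mu (enum_val i)]|.
pose i0 := enum_rank (0 : bits n).
have mi0 : m i0 = #|M|.
  apply: eq_card => mu; rewrite !inE enum_rankK.
  by rewrite (_ : passes mu 0) ?andbT //; apply/forallP => j; rewrite ffunE implybT.
have OmegaE w : Omega *m graph_basis w =
    (#|[set mu in M | passes mu w]|%:R / #|M|%:R) *: graph_basis w.
  have -> : #|[set mu in M | passes mu w]| = (\sum_(mu in M) passes mu w)%N.
    by rewrite -sum1dep_card big_mkcondr; apply: eq_bigr => mu _; case: (passes mu w).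
  rewrite mulmx_suml natr_sum mulr_suml scaler_suml; apply: eq_bigr => mu Mmu.
  rewrite -scalemxAl test_proj_graph_basis; first by rewrite scalerA mulrC.
  by move=> j; apply: M_gen.
apply: (@second_eigenvalue_counts Omega m i0); rewrite ?mi0 //.
  pose U : 'M[C]_#|{: bits n}| := \matrix_(a, i) graph_basis (enum_val i) a 0.
  have UU : U^t* *m U = 1%:M.
    apply/matrixP => i k.
    have /matrixP/(_ 0 0) := graph_basis_orthonormal (enum_val i) (enum_val k).
    rewrite (inj_eq enum_val_inj) !mxE eqxx mulr1n => <-.
    by apply: eq_bigr => a _; rewrite !mxE.
  rewrite (@char_poly_diagonalized _ _ _ U (\row_i ((m i)%:R / #|M|%:R))).
  - by apply: eq_bigr => i _; rewrite mxE.
  - by have [] := mulmx1_unit UU.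
  apply/matrixP => a i; have /matrixP/(_ a 0) := OmegaE (enum_val i).
  rewrite mul_mx_diag [in RHS]mxE => e.
  rewrite [RHS]mxE [U a i]mxE [(\row_ _ _) _ _]mxE mulrC -e !mxE.
  by apply: eq_bigr => k _; rewrite [U k i]mxE.
(* A nonzero string has a 1 at some [j] and fails a setting that measures X there. *)
move=> i ni; apply: proper_card; apply/properP; split.
  by apply/fintype.subsetP => mu; rewrite inE => /andP[].
have [j nj] : exists j, (enum_val i : bits n) j != (0 : bits n) j.
  by apply: neq_ffun; apply: contraNneq ni => w0; rewrite -(enum_valK i) w0.
have wj : (enum_val i : bits n) j == 1.
  by move: nj; rewrite ffunE; case: ((enum_val i : bits n) j) => [[|[|//]] ?].
have [mu Mmu mj] := M_cover j; exists mu => //.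
by rewrite inE Mmu /=; apply/forallPn; exists j; rewrite mj eqxx wj.
Qed.

End Verification.

(** Colors with an empty class all yield the all-Z setting, hence only an upper bound on the number
    of settings. *)
Lemma coloring_verifies (C : numClosedFieldType) n (G : sgraph n) k :
  (0 < k)%N -> colorable G k -> exists M : {set setting n},
    [/\ XZ_settings M, can_verify C G M & (#|M| <= k)%N].
Proof.
move=> k0 [c cP].
pose mu (i : 'I_k) : setting n := [ffun j => if c j == i then PauliX else PauliZ].
exists [set mu i | i : 'I_k]; split.
- move=> _ /imsetP[i _ ->] j; rewrite ffunE; case: ifP => _; exact/eqP.
- have [psi psiG] := graph_state_exists C G; apply: (settings_verify psiG).
  + by apply/card_gt0P; exists (mu (Ordinal k0)); apply: imset_f.
  + move=> _ j /imsetP[i _ ->]; rewrite ffunE; case: eqP => // cj _ l.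
    rewrite ffunE /gen; have [->|nlj] := eqVneq l j; first by rewrite cj eqxx adj_irr.
    case Gjl: (G j l); last by case: ifP.
    by have := cP _ _ Gjl; rewrite cj eq_sym => /negPf->.
  + by move=> j; exists (mu (c j)); [exact: imset_f | rewrite ffunE eqxx].
- by rewrite -[leqRHS]card_ord; apply: leq_imset_card.
Qed.

(** * The minimum numbers of settings for odd rings *)

Lemma XZ_two_paulis n (M : {set setting n}) : XZ_settings M -> two_paulis_per_qubit M.
Proof.
move=> XZ j.
have le2 : (#|[set PauliX; PauliZ]| <= 2)%N by rewrite cards2; case: (_ != _).
apply: leq_trans le2; apply/subset_leq_card/fintype.subsetP => _ /imsetP[mu Mmu ->].
by move: (XZ _ Mmu j); rewrite !inE; case: (mu j) => //; rewrite !eqxx ?orbT.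
Qed.

(** One argument serves all three numbers: the lower bound holds for any verifying set, and the
    settings from a 3-coloring meet the strictest restriction. *)
Lemma ring_min_settings (C : numClosedFieldType) n (G : sgraph n)
    (restr : {set setting n} -> Prop) :
  (5 <= n)%N -> odd n -> is_ring_graph G ->
  (forall M, XZ_settings M -> restr M) -> min_settings C restr G = 3%N.
Proof.
move=> n5 n_odd ringG XZ_restr.
have gt2 M : can_verify C G M -> (2 < #|M|)%N.
  move=> verM; rewrite ltnNge; apply/negP => /(few_settings_splits verM)[mu1 [mu2]].
  exact: odd_ring_graph_not_splits.
apply: minimumP => [|m [M [_ /gt2 + <-]] //].
have [M [XZ verM M3]] := coloring_verifies (k := 3) C isT (ring_colorable3 ringG).
by exists M; split; [exact: XZ_restr | | apply/eqP; rewrite eqn_leq M3 gt2].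
Qed.

Theorem proposition8 (R : realType) (n : nat) (G : sgraph n)
    (hn : (5 <= n)%N) (hodd : odd n) (hG : is_ring_graph G) :
  [/\ chi_tilde R[i] G = chi_tilde2 R[i] G,
      chi_tilde2 R[i] G = chi_tildeXZ R[i] G,
      chi_tildeXZ R[i] G = LC_chromatic_number G,
      LC_chromatic_number G = chromatic_number G
    & chromatic_number G = 3%N].
Proof.
rewrite /chi_tilde /chi_tilde2 /chi_tildeXZ ring_LC_chromatic_number //.
rewrite ring_chromatic_number //.
by rewrite !ring_min_settings //; apply: XZ_two_paulis.
Qed.
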